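(* Let $\mathbf{G}$ be a finite nilpotent group and let $\mathcal{V}$ be the variety of groups generated by $\mathbf{G}$. Then the class $\mathcal{V}_{\mathrm{si}}$ of all subdirectly irreducible groups belonging to $\mathcal{V}$ is axiomatisable by a finite set of elementary sentences; that is, there is a finite set $\Sigma$ of first-order sentences in the language of groups such that a structure $\mathbf{A}$ for this language belongs to $\mathcal{V}_{\mathrm{si}}$ if and only if $\mathbf{A}$ satisfies every sentence in $\Sigma$.
   Context: The language of groups has a binary operation symbol (multiplication), a unary operation symbol (inverse) and a constant symbol $1$ (identity). Elementary formulas and sentences are those of first-order logic with equality in this language (variables range over elements only). A variety of groups is a class of groups closed under homomorphic images, subgroups and arbitrary direct products. The variety generated by $\mathbf{G}$ is the smallest variety containing $\mathbf{G}$. A group $\mathbf{S}$ is subdirectly irreducible (monolithic) if it has a nontrivial normal subgroup, called its monolith, that is contained in every nontrivial normal subgroup of $\mathbf{S}$. In particular the trivial group is not subdirectly irreducible. *)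

(* Defs.v *)
From HB Require Import structures.
From mathcomp Require Import all_boot all_fingroup all_solvable.
From Stdlib Require List.

Set Implicit Arguments.
Unset Strict Implicit.
Unset Printing Implicit Defensive.

Local Open Scope group_scope.

(* A [baseGroupType] carries a multiplication, an inverse and a unit subject to
   no axiom (and no decidability or choice assumption): it is an arbitrary
   structure, possibly infinite, for the first-order language of groups. *)

Inductive term : Set :=
| Var of nat
| One
| Inv of term
| Mul of term & term.

Inductive formula : Set :=
| Eq of term & term
| Bot
| Not of formula
| And of formula & formula
| Or of formula & formula
| Imp of formula & formula
| All of nat & formula
| Ex of nat & formula.

Fixpoint term_vars (t : term) : seq nat :=
  match t with
  | Var n => [:: n]
  | One => [::]
  | Inv t1 => term_vars t1
  | Mul t1 t2 => term_vars t1 ++ term_vars t2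
  end.

Fixpoint free_vars (f : formula) : seq nat :=
  match f with
  | Eq t1 t2 => term_vars t1 ++ term_vars t2
  | Bot => [::]
  | Not f1 => free_vars f1
  | And f1 f2 | Or f1 f2 | Imp f1 f2 => free_vars f1 ++ free_vars f2
  | All n f1 | Ex n f1 => [seq m <- free_vars f1 | m != n]
  end.

Definition sentence (f : formula) : Prop := free_vars f = [::].

Definition update (A : Type) (e : nat -> A) (n : nat) (a : A) : nat -> A :=
  fun m => if m == n then a else e m.

Fixpoint term_eval (A : baseGroupType) (e : nat -> A) (t : term) : A :=
  match t with
  | Var n => e n
  | One => 1
  | Inv t1 => (term_eval e t1)^-1
  | Mul t1 t2 => term_eval e t1 * term_eval e t2
  end.

Fixpoint holds (A : baseGroupType) (e : nat -> A) (f : formula) : Prop :=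
  match f with
  | Eq t1 t2 => term_eval e t1 = term_eval e t2
  | Bot => False
  | Not f1 => ~ holds e f1
  | And f1 f2 => holds e f1 /\ holds e f2
  | Or f1 f2 => holds e f1 \/ holds e f2
  | Imp f1 f2 => holds e f1 -> holds e f2
  | All n f1 => forall a : A, holds (update e n a) f1
  | Ex n f1 => exists a : A, holds (update e n a) f1
  end.

(* For a sentence the valuation is irrelevant. *)
Definition satisfies (A : baseGroupType) (f : formula) : Prop :=
  forall e : nat -> A, holds e f.

Definition is_group (A : baseGroupType) : Prop :=
  [/\ associative (@mul A),
      left_id (1 : A) mul /\ right_id (1 : A) mul,
      left_inverse (1 : A) inv mul & right_inverse (1 : A) inv mul].

Definition is_hom (A B : baseGroupType) (f : A -> B) : Prop :=
  [/\ f 1 = 1, {morph f : x y / x * y} & {morph f : x / x^-1}].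

Definition is_surjective (A B : Type) (f : A -> B) : Prop :=
  forall b : B, exists a : A, f a = b.

Record subgroup (A : baseGroupType) := Subgroup {
  sg_mem :> A -> Prop;
  sg_1 : sg_mem 1;
  sg_M : forall x y, sg_mem x -> sg_mem y -> sg_mem (x * y);
  sg_V : forall x, sg_mem x -> sg_mem x^-1
}.

Definition subgroup_sort (A : baseGroupType) (H : subgroup A) : Type :=
  {x : A | H x}.

Section SubgroupStructure.
Variables (A : baseGroupType) (H : subgroup A).

HB.instance Definition _ := hasMul.Build (subgroup_sort H)
  (fun x y => exist H _ (sg_M (proj2_sig x) (proj2_sig y))).
HB.instance Definition _ := hasOne.Build (subgroup_sort H)
  (exist H _ (sg_1 H)).
HB.instance Definition _ := hasInv.Build (subgroup_sort H)
  (fun x => exist H _ (sg_V (proj2_sig x))).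

End SubgroupStructure.

Definition product_structure (I : Type) (A : I -> baseGroupType) : Type :=
  forall i, A i.

Section DirectProductStructure.
Variables (I : Type) (A : I -> baseGroupType).

HB.instance Definition _ := hasMul.Build (product_structure A)
  (fun x y i => x i * y i).
HB.instance Definition _ := hasOne.Build (product_structure A) (fun i => 1).
HB.instance Definition _ := hasInv.Build (product_structure A)
  (fun x i => (x i)^-1).

End DirectProductStructure.

Definition is_variety (V : baseGroupType -> Prop) : Prop :=
  [/\ forall A : baseGroupType, V A -> is_group A,
      forall (A B : baseGroupType) (f : A -> B),
        is_hom f -> is_surjective f -> V A -> V B,
      forall (A : baseGroupType) (H : subgroup A), V A -> V (subgroup_sort H)
    & forall (I : Type) (A : I -> baseGroupType),
        (forall i, V (A i)) -> V (product_structure A)].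

Definition variety_generated_by (G A : baseGroupType) : Prop :=
  forall V : baseGroupType -> Prop, is_variety V -> V G -> V A.

Definition is_normal (A : baseGroupType) (N : subgroup A) : Prop :=
  forall x g : A, N x -> N (x ^ g).

Definition is_nontrivial (A : baseGroupType) (N : subgroup A) : Prop :=
  exists2 x : A, N x & x <> 1.

Definition is_monolith (A : baseGroupType) (M : subgroup A) : Prop :=
  [/\ is_normal M, is_nontrivial M
    & forall N : subgroup A,
        is_normal N -> is_nontrivial N -> forall x, M x -> N x].

Definition subdirectly_irreducible (A : baseGroupType) : Prop :=
  is_group A /\ exists M : subgroup A, is_monolith M.

(* Main.v *)
Require Import Defs.
From HB Require Import structures.
From mathcomp Require Import all_boot all_fingroup all_solvable.
From mathcomp Require Import boolp.
From Stdlib Require List.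

(* The variety generated by [G] is the class of models of the laws of [G]
   (Birkhoff), and for each [n] the laws of [G] in [n] variables follow from
   finitely many of them because the free group of rank [n] in the variety is
   finite.  If [A] is nilpotent of class at most [c], a word that vanishes on
   all tuples of [A] with at most [c] entries different from [1] vanishes
   identically: restricting a tuple to all subsets of its entries gives a point
   of the cube [A ^ (2 ^ k)] lying in the Host-Kra type filtration built from a
   central filtration of [A], and such a point is determined by its values on
   the corners of weight at most [c].  Hence the laws in [c + 3] variables
   imply all laws of [G].  Finally, every nontrivial normal subgroup of a
   nilpotent group meets the centre, so [A] is subdirectly irreducible iff some
   [x <> 1] is a power of every central [y <> 1]; as the exponent is bounded,
   this is one first-order sentence. *)

Set Implicit Arguments.
Unset Strict Implicit.
Unset Printing Implicit Defensive.

Local Open Scope group_scope.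

(** * Structures that satisfy the group axioms *)

Lemma is_group_groupType (A : baseGroupType) :
  is_group A -> exists H : groupType, H = A :> baseGroupType.
Proof.
case=> mA [m1 m1'] mV mV'.
have V_uniq (x y : A) : x * y = 1 -> x = y^-1.
  by move=> xy1; rewrite -(m1' x) -(mV' y) mA xy1 m1.
have VK : involutive (@inv A) by move=> x; rewrite -(V_uniq x) // mV'.
have VM : {morph @inv A : x y / x * y >-> y * x}.
  move=> x y; symmetry; apply: V_uniq.
  by rewrite mA -(mA y^-1) mV m1' mV.
case: A mA m1 m1' mV mV' V_uniq VK VM => T c mA m1 m1' mV _ _ VK VM.
pose B : baseGroupType := HB.pack T c.
(* [groupType] also asks for decidable equality and choice, which classical logic supplies on any
   carrier. *)
pose H : groupType := HB.pack T c (gen_eqMixin T) (gen_choiceMixin T)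
  (Magma_isSemigroup.Build B mA) (BaseUMagma_isUMagma.Build B m1 m1')
  (Monoid_isStarMonoid.Build B VK VM) (StarMonoid_isGroup.Build B mV).
by exists H.
Qed.

Lemma groupType_is_group (H : groupType) : is_group H.
Proof.
split; [exact: mulgA | split; [exact: mul1g | exact: mulg1] | exact: mulVg |].
exact: mulgV.
Qed.

(** Rewriting to left-associated reduced words, used to verify identities of free groups. *)
Definition gnormE (H : groupType) :=
  (@invgM H, @invgK H, @mulgA H, @mulgK H, @mulgKV H, @mulgV H, @mulVg H,
   @mul1g H, @mulg1 H, @invg1 H).

(** * Central filtrations and the upper central series *)

Section Filtrations.

Variable H : groupType.
Implicit Types (x y z : H) (F : nat -> H -> Prop).

Record is_filtration F : Prop := IsFiltration {
  filt1 : forall i, F i 1;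
  filtM : forall i x y, F i x -> F i y -> F i (x * y);
  filtV : forall i x, F i x -> F i x^-1;
  filtS : forall i x, F i.+1 x -> F i x;
  filtR : forall i j x y, F i x -> F j y -> F (i + j) [~ x, y]
}.

Lemma filtD F : is_filtration F -> forall i k x, F (i + k) x -> F i x.
Proof.
move=> hF i k x; elim: k => [|k IHk]; rewrite ?addn0 // addnS.
by move/(filtS hF).
Qed.

Lemma filtJ F : is_filtration F ->
  forall i x y, F i x -> F 0 y -> F i (x ^ y).
Proof.
move=> hF i x y Fx Fy; have -> : x ^ y = x * [~ x, y].
  by rewrite commgEl mulKVg.
by apply: (filtM hF) => //; rewrite -[i]addn0; apply: (filtR hF).
Qed.

Fixpoint ucs (n : nat) x : Prop :=
  if n is n'.+1 then forall y, ucs n' [~ x, y] else x = 1.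

Lemma ucsJ n x y : ucs n x -> ucs n (x ^ y).
Proof.
elim: n x y => [|n IHn] x y /= => [->|Zx z]; first by rewrite conj1g.
by rewrite -[z](conjgKV y) -conjRg; apply: IHn.
Qed.

Lemma commMgE x y z : [~ x * y, z] = [~ x, z] ^ y * [~ y, z].
Proof. by rewrite !commgEl !conjgE !gnormE. Qed.

Lemma commgME x y z : [~ x, y * z] = [~ x, z] * [~ x, y] ^ z.
Proof. by rewrite !commgEl !conjgE !gnormE. Qed.

Lemma commVgE x z : [~ x^-1, z] = ([~ x, z] ^ x^-1)^-1.
Proof. by rewrite !commgEl !conjgE !gnormE. Qed.

Lemma invg_commE x y : [~ x, y]^-1 = [~ y, x].
Proof. by rewrite !commgEl !conjgE !gnormE. Qed.

Lemma Hall_Witt x y z :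
  [~ x, y^-1, z] ^ y * [~ y, z^-1, x] ^ z * [~ z, x^-1, y] ^ x = 1.
Proof. by rewrite !commgEl !conjgE !gnormE. Qed.

Lemma ucs1 n : ucs n 1.
Proof. by elim: n => //= n IHn y; rewrite comm1g. Qed.

Lemma ucsM n x y : ucs n x -> ucs n y -> ucs n (x * y).
Proof.
elim: n x y => [|n IHn] x y /= => [-> ->|Zx Zy z]; first exact: mulg1.
by rewrite commMgE; apply: IHn => //; apply: ucsJ.
Qed.

Lemma ucsV n x : ucs n x -> ucs n x^-1.
Proof.
elim: n x => [|n IHn] x /= => [->|Zx z]; first exact: invg1.
by rewrite commVgE; apply/IHn/ucsJ.
Qed.

Lemma ucsS n x : ucs n x -> ucs n.+1 x.
Proof.
by move=> Zx y /=; rewrite commgEl; apply: ucsM; [apply: ucsV | apply: ucsJ].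
Qed.

Lemma ucsW m n x : m <= n -> ucs m x -> ucs n x.
Proof.
move/subnKC <-; elim: (n - m) => [|k IHk]; rewrite ?addn0 ?addnS // => Zx.
by apply/ucsS/IHk.
Qed.

Lemma ucsP n x y : ucs n x -> ucs n.-1 [~ x, y].
Proof. by case: n => [->|n] /=; [rewrite comm1g | apply]. Qed.

(** Stands in for the lower central term $\gamma_j$, which satisfies $[Z_l, \gamma_j] \le Z_{l-j}$;
    the condition is elementwise and avoids generated subgroups. *)
Definition ucs_lower j x := forall l z, ucs l z -> ucs (l - j) [~ x, z].

Lemma ucs_lowerV j x : ucs_lower j x -> ucs_lower j x^-1.
Proof. by move=> Fx l z Zz; rewrite commVgE; apply/ucsV/ucsJ/Fx. Qed.

Lemma ucs_lowerM j x y : ucs_lower j x -> ucs_lower j y -> ucs_lower j (x * y).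
Proof.
by move=> Fx Fy l z Zz; rewrite commMgE; apply: ucsM; [apply/ucsJ/Fx|apply: Fy].
Qed.

Lemma ucs_lowerR i j x y :
  ucs_lower i x -> ucs_lower j y -> ucs_lower (i + j) [~ x, y].
Proof.
move=> Fx Fy l z Zz.
have comm_lower k a b n : ucs_lower k a -> ucs n b -> ucs (n - k) [~ b, a].
  by move=> Fa Zb; rewrite -invg_commE; apply/ucsV/Fa.
have H2 : ucs (l - (i + j)) [~ y^-1, z^-1, x].
  rewrite addnC subnDA; apply: comm_lower => //.
  by apply: (ucs_lowerV Fy); apply: ucsV.
have H3 : ucs (l - (i + j)) [~ z, x^-1, y^-1].
  rewrite subnDA; apply: (comm_lower _); first exact: ucs_lowerV.
  by apply: (comm_lower _) => //; apply: ucs_lowerV.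
(* As in the three subgroups lemma: at $y^{-1}$ the first Hall-Witt factor is a conjugate of
   $[x, y, z]$, and [H2], [H3] control the other two. *)
have /eqP := Hall_Witt x y^-1 z; rewrite invgK -mulgA mulg_eq1 => /eqP HW.
rewrite -[X in ucs _ X](conjgK y^-1) HW invgK.
by apply/ucsJ/ucsV/ucsM; apply: ucsJ.
Qed.

(** The first condition kills all terms of index above [c], the second yields the commutator
    inclusions. If the group has class at most [c], terms 0 and 1 are the whole group. *)
Definition nil_filt c j x := ucs (c.+1 - j) x /\ ucs_lower j x.

Lemma nil_filt_filtration c : is_filtration (nil_filt c).
Proof.
split.
- by move=> i; split=> [|l z _]; rewrite ?comm1g; apply: ucs1.
- move=> i x y [Zx Fx] [Zy Fy]; split; [exact: ucsM | exact: ucs_lowerM].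
- by move=> i x [Zx Fx]; split; [exact: ucsV | exact: ucs_lowerV].
- move=> i x [Zx Fx]; split; first by apply: ucsW Zx; rewrite leq_sub2l.
  by move=> l z /Fx; apply: ucsW; rewrite leq_sub2l.
- move=> i j x y [Zx Fx] [Zy Fy]; split; last exact: ucs_lowerR.
  by rewrite addnC subnDA; apply: Fx.
Qed.

Lemma nil_filtT c x i : (forall y : H, ucs c y) -> i <= 1 -> nil_filt c i x.
Proof.
move=> nilH le_i1; split=> [|l z].
  apply: ucsW (nilH x).
  by rewrite leq_subRL ?(leq_trans le_i1) // -add1n leq_add2r.
move=> Zz; apply: (@ucsW l.-1); first by rewrite -subn1 leq_sub2l.
by rewrite -invg_commE; apply/ucsV/ucsP.
Qed.

End Filtrations.

(** * Host-Kra cubes over a filtered group *)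

Section PairFiltration.

Variables (H : groupType) (F : nat -> H -> Prop).
Hypothesis hF : is_filtration F.

(** Pairs $(x, xu)$ with $x \in F_j$ and $u \in F_{j+1}$: one step of the cube construction. *)
Definition pair_filt j (p : H * H) := F j p.1 /\ F j.+1 (p.1^-1 * p.2).

Lemma pair_filtration : is_filtration (H := (H * H)%type) pair_filt.
Proof.
have hW i k x : F (i + k) x -> F i x by apply: filtD.
have F0 i x : F i x -> F 0 x by apply: (hW 0%N i).
split.
- by move=> i; split; rewrite /= ?mulg1 ?invg1; apply: filt1.
- move=> i [x a] [y b] [/= Fx Fu] [/= Fy Fv]; split=> /=; first exact: filtM.
  have -> : (x * y)^-1 * (a * b) = (x^-1 * a) ^ y * (y^-1 * b).
    by rewrite conjgE !gnormE.
  by apply: (filtM hF) => //; apply: (filtJ hF) => //; apply: F0 Fy.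
- move=> i [x a] [/= Fx Fu]; split=> /=; first exact: filtV.
  have -> : x^-1^-1 * a^-1 = ((x^-1 * a)^-1) ^ x^-1 by rewrite conjgE !gnormE.
  by apply: (filtJ hF); [exact: filtV | apply/(filtV hF)/(F0 _ _ Fx)].
- by move=> i p [/(filtS hF) ? /(filtS hF)].
move=> i j [x a] [y b] [/= Fx Fu] [/= Fy Fv]; split=> /=; first exact: filtR.
set u := x^-1 * a in Fu; set v := y^-1 * b in Fv.
have -> : a = x * u by rewrite mulKVg.
have -> : b = y * v by rewrite mulKVg.
have Fb : F j (y * v) by apply: (filtM hF) => //; apply: (filtS hF).
have Fc : F (i + j) [~ x, y] by apply: filtR.
have Fvu : F 1%N (v * u).
  by apply: (filtM hF); [apply: (hW 1%N j) | apply: (hW 1%N i)].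
(* Each of the three factors lies in $F_{i+j+1}$: the extra 1 comes from $v$, from $vu \in F_1$ and
   from $u$ respectively. *)
have -> : [~ x, y]^-1 * [~ x * u, y * v] =
    [~ x, v] ^ (u * [~ x, y]) * [~ [~ x, y], v * u] * [~ u, y * v].
  rewrite commMgE [in [~ x, y * v]]commgME conjMg -conjgM.
  rewrite [[~ [~ _, _], _]]commgEl.
  by rewrite !conjgM !conjgE !gnormE.
apply: (filtM hF); first apply: (filtM hF).
- apply: (filtJ hF); first by rewrite -addnS; apply: filtR.
  by apply: (filtM hF); [apply: F0 Fu | apply: F0 Fc].
- by rewrite -addn1; apply: filtR.
- by rewrite -addSn; apply: filtR.
Qed.

End PairFiltration.

Fixpoint hypercube (H : groupType) (k : nat) : groupType :=
  if k is k'.+1 then (hypercube H k' * hypercube H k')%type else H.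

Section Hypercube.

Variable H : groupType.
Implicit Types (x : H) (a : nat -> H) (s : nat -> bool).

Fixpoint cube_filt (F : nat -> H -> Prop) k : nat -> hypercube H k -> Prop :=
  if k is k'.+1 then pair_filt (@cube_filt F k') else F.

Fixpoint corner k s : hypercube H k -> H :=
  if k is k'.+1
  then fun p => corner (fun i => s i.+1) (if s 0 then p.2 else p.1)
  else id.

Fixpoint cube_diag k x : hypercube H k :=
  if k is k'.+1 then (cube_diag k' x, cube_diag k' x) else x.

(** Equal to [a i] on the face where bit [i] is set and to 1 elsewhere, so a word evaluated at these
    points shows at corner [s] its value on the part of [a] selected by [s]. *)
Fixpoint cube_point k a i : hypercube H k :=
  match k with
  | 0 => 1
  | k'.+1 => if i is i'.+1
             then let p := cube_point k' (fun i => a i.+1) i' in (p, p)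
             else (1, cube_diag k' (a 0))
  end.

Lemma cornerM k s : {morph @corner k s : x y / x * y}.
Proof.
elim: k s => [|k IHk] s //= [x1 x2] [y1 y2] /=.
by case: (s 0); apply: IHk.
Qed.

Lemma corner1 k s : @corner k s 1 = 1.
Proof. by elim: k s => [|k IHk] s //=; case: (s 0); apply: IHk. Qed.

Lemma cornerV k s : {morph @corner k s : x / x^-1}.
Proof.
by move=> x; apply: (mulgI (corner s x)); rewrite mulgV -cornerM mulgV corner1.
Qed.

Lemma corner_diag k s x : corner s (cube_diag k x) = x.
Proof. by elim: k s => [|k IHk] s //=; case: (s 0); apply: IHk. Qed.

Lemma corner_point k s a i :
  corner s (cube_point k a i) = if (i < k) && s i then a i else 1.
Proof.
elim: k s a i => [|k IHk] s a [|i] //=.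
  by case: (s 0); rewrite ?corner_diag ?corner1.
by rewrite ltnS; case: (s 0); rewrite IHk.
Qed.

Lemma corner_eval k s (e : nat -> hypercube H k) t :
  corner s (term_eval e t) = term_eval (fun i => corner s (e i)) t.
Proof.
elim: t => //= [|t <-|t1 <- t2 <-].
- exact: corner1.
- exact: cornerV.
- exact: cornerM.
Qed.

Section Filtered.

Variable F : nat -> H -> Prop.
Hypotheses (hF : is_filtration F) (F1T : forall x, F 1 x).

Lemma cube_filtration k : is_filtration (@cube_filt F k).
Proof. by elim: k => [|k IHk] //=; apply: pair_filtration. Qed.

Lemma cube_filt_diag k j x : F j x -> cube_filt F j (cube_diag k x).
Proof.
move=> Fx; elim: k => [|k IHk] //=; split=> //=.
by rewrite mulVg; apply: (filt1 (cube_filtration k)).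
Qed.

Lemma cube_filt_point k a i : cube_filt F 0 (cube_point k a i).
Proof.
elim: k a i => [|k IHk] a i; first exact: (filt1 hF).
have hFk := cube_filtration k.
case: i => [|i]; split=> /=.
- exact: (filt1 hFk).
(* The two halves differ by a diagonal element, required at level 1; this is where $F_1$ must be
   everything. *)
- by rewrite invg1 mul1g; apply: cube_filt_diag.
- exact: IHk.
- by rewrite mulVg; apply: (filt1 hFk).
Qed.

Lemma cube_filt_eval k (e : nat -> hypercube H k) t :
  (forall i, cube_filt F 0 (e i)) -> cube_filt F 0 (term_eval e t).
Proof.
have hFk := cube_filtration k.
move=> Fe; elim: t => //= [|t|t1 IH1 t2 IH2].
- exact: (filt1 hFk).
- exact: (filtV hFk).
- exact: (filtM hFk).
Qed.

(* An element of the filtered cube is determined by its values at the corners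
   of weight at most [c]: its differences in more than [c] directions lie in
   a trivial term of the filtration. *)
Lemma cube_filt_eq1 c k j (f : hypercube H k) :
    (forall i x, c < i -> F i x -> x = 1) -> cube_filt F j f ->
    (forall s, \sum_(i < k) s i + j <= c -> corner s f = 1) ->
  forall s, corner s f = 1.
Proof.
move=> Fc; elim: k j f => [|k IHk] j f /=.
  move=> Ff f1 s; have [lt_cj|le_jc] := ltnP c j.
    exact: (Fc j f).
  by apply: (f1 s); rewrite big_ord0.
case: f => f0 f1 [/= Ff0 Fd] fs.
pose scons b s i := if i is i'.+1 then s i' else b : bool.
have sum_scons b s : \sum_(i < k.+1) scons b s i = b + \sum_(i < k) s i.
  by rewrite big_ord_recl.
have f0_1 s : corner s f0 = 1.
  apply: (IHk j) => // {}s le_sc.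
  by apply: (fs (scons false s)); rewrite sum_scons.
have f1_1 s : corner s f1 = 1.
  (* The difference of the halves lies one level higher, and corners of [f1] carry one more bit, so
     the bound [c] is preserved. *)
  rewrite -[f1](mulKVg f0) cornerM f0_1 mul1g.
  apply: (IHk j.+1) => // {}s le_sc; rewrite cornerM cornerV f0_1 invg1 mul1g.
  by apply: (fs (scons true s)); rewrite sum_scons addSnnS.
by move=> s; case: (s 0); [apply: f1_1 | apply: f0_1].
Qed.

End Filtered.
End Hypercube.

(** * Words determined by tuples of small support *)

Lemma eq_term_eval (A : baseGroupType) (e1 e2 : nat -> A) t :
  {in term_vars t, e1 =1 e2} -> term_eval e1 t = term_eval e2 t.
Proof.
elim: t => //= [n e12|t IHt /IHt-> //|t1 IH1 t2 IH2 e12].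
  by apply: e12; rewrite inE.
by rewrite IH1 ?IH2 // => i ti; apply: e12; rewrite mem_cat ti ?orbT.
Qed.

Lemma small_support_law (H : groupType) c t1 t2 :
    (forall x : H, ucs c x) ->
    (forall (S : seq nat) (a : nat -> H), size S <= c ->
       (forall i, i \notin S -> a i = 1) -> term_eval a t1 = term_eval a t2) ->
  forall a : nat -> H, term_eval a t1 = term_eval a t2.
Proof.
move=> nilH small a; pose w := Mul t1 (Inv t2).
have [k lt_k] : exists k, forall i, i \in term_vars w -> i < k.
  exists (\max_(i <- term_vars w) i).+1 => i wi.
  by rewrite ltnS; apply: leq_bigmax_seq.
have hF := nil_filt_filtration H c.
have F1T (x : H) : nil_filt c 1 x by apply: nil_filtT.
have Fc i (x : H) : c < i -> nil_filt c i x -> x = 1.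
  by rewrite -subn_eq0 => /eqP c_i []; rewrite c_i.
have /(cube_filt_eq1 Fc) :
    cube_filt (nil_filt c) 0 (term_eval (cube_point k a) w).
  by apply: cube_filt_eval => // i; apply: cube_filt_point.
have corner_w s : corner s (term_eval (cube_point k a) w)
    = term_eval (fun i => if (i < k) && s i then a i else 1) w.
  by rewrite corner_eval; apply: eq_term_eval => i _; apply: corner_point.
(* The all-true corner carries the value of [w] at the full tuple; corners of weight at most [c]
   carry its values on restrictions with at most [c] entries. *)
move/(_ _ (fun=> true)); rewrite corner_w.
rewrite (eq_term_eval (e2 := a)) => [w1|i /lt_k -> //].
apply/(mulIg (term_eval a t2)^-1); rewrite mulgV; apply: w1 => s.
rewrite addn0 corner_w => sum_s /=.
rewrite (small [seq i <- iota 0 k | s i]) ?mulgV // => [|i].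
  apply: leq_trans sum_s; rewrite size_filter -sum1_count big_mkcond /=.
  by rewrite -[in iota _ _](subn0 k) big_mkord leq_sum // => i _; case: (s i).
by rewrite mem_filter mem_iota /= add0n andbC => /negPf->.
Qed.

(** * Laws and Birkhoff's theorem *)

Fixpoint subst (u : nat -> term) (t : term) : term :=
  match t with
  | Var n => u n
  | One => One
  | Inv t1 => Inv (subst u t1)
  | Mul t1 t2 => Mul (subst u t1) (subst u t2)
  end.

Lemma eval_subst (A : baseGroupType) (e : nat -> A) u t :
  term_eval e (subst u t) = term_eval (fun i => term_eval e (u i)) t.
Proof. by elim: t => //= [t -> | t1 -> t2 ->]. Qed.

Lemma hom_eval (A B : baseGroupType) (f : A -> B) (e : nat -> A) t :
  is_hom f -> f (term_eval e t) = term_eval (fun i => f (e i)) t.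
Proof. by case=> f1 fM fV; elim: t => //= [t <-|t1 <- t2 <-]. Qed.

Definition models_laws (G A : baseGroupType) : Prop :=
  forall t1 t2, satisfies G (Eq t1 t2) -> satisfies A (Eq t1 t2).

(** The group axioms are laws of [G] in at most three variables. Laws in the first $n$ variables are
    encoded by valuations equal to 1 from index $n$ on. *)
Lemma is_group_of_laws (G A : baseGroupType) :
    is_group G ->
    (forall t1 t2, satisfies G (Eq t1 t2) -> forall e : nat -> A,
       (forall i, 3 <= i -> e i = 1) -> term_eval e t1 = term_eval e t2) ->
  is_group A.
Proof.
case=> mG [m1 m1'] mV mV' GA; pose e (x y z : A) i := nth 1 [:: x; y; z] i.
have law t1 t2 x y z : satisfies G (Eq t1 t2) ->
    term_eval (e x y z) t1 = term_eval (e x y z) t2.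
  by move=> G12; apply: GA => // i i_ge3; apply: nth_default.
split; [|split|..] => x; first move=> y z.
- by apply: (law (Mul (Var 0) (Mul (Var 1) (Var 2)))
                 (Mul (Mul (Var 0) (Var 1)) (Var 2)) x y z) => u /=.
- by apply: (law (Mul One (Var 0)) (Var 0) x x x) => u /=.
- by apply: (law (Mul (Var 0) One) (Var 0) x x x) => u /=.
- by apply: (law (Mul (Inv (Var 0)) (Var 0)) One x x x) => u /=.
- by apply: (law (Mul (Var 0) (Inv (Var 0))) One x x x) => u /=.
Qed.

Lemma models_laws_group (G A : baseGroupType) :
  is_group G -> models_laws G A -> is_group A.
Proof.
by move=> gG GA; apply: is_group_of_laws gG _ => t1 t2 G12 e _; apply: GA.
Qed.

Lemma models_laws_variety (G : baseGroupType) :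
  is_group G -> is_variety (models_laws G).
Proof.
move=> gG; split.
- by move=> A; apply: models_laws_group.
- move=> A B f homf surjf GA t1 t2 /GA A12 e /=.
  have /choice[g gK] i : exists a, f a = e i by apply: surjf.
  rewrite -(funext gK : (fun i => f (g i)) = e) -!hom_eval //; congr f.
  exact: A12.
- move=> A H GA t1 t2 /GA A12 e /=.
  have hom_sval : is_hom (fun x : subgroup_sort H => sval x : A) by split.
  have sval_inj (x y : subgroup_sort H) : sval x = sval y -> x = y.
    by case: x y => x Hx [y Hy]; apply: eq_exist.
  by apply: sval_inj; rewrite !(hom_eval _ _ hom_sval); apply: A12.
- move=> I A GA t1 t2 G12 e /=; apply: functional_extensionality_dep => i.
  have hom_i : is_hom (fun x : product_structure A => x i) by split.
  by rewrite !(hom_eval _ _ hom_i); apply: GA.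
Qed.

Section Birkhoff.

Variables (G A : baseGroupType).
Hypothesis GA : models_laws G A.

(** Maps [A -> G] cannot separate variables on which [e] agrees. Renaming each variable to a chosen
    one with the same value turns the hypothesis into a law of [G]. *)
Lemma eval_eq_of_free (e : nat -> A) t1 t2 :
    (forall v : A -> G, term_eval (fun i => v (e i)) t1
                      = term_eval (fun i => v (e i)) t2) ->
  term_eval e t1 = term_eval e t2.
Proof.
move=> e12.
have /choice[r rP] a : exists j, (exists i, e i = a) -> e j = a.
  by case: (EM (exists i, e i = a)) => [[i ei]|nea]; [exists i | exists 0].
pose u i := Var (r (e i)).
have eval_u t : term_eval e (subst u t) = term_eval e t.
  by rewrite eval_subst; apply: eq_term_eval => i _; apply: rP; exists i.
rewrite -eval_u -[RHS]eval_u; apply: GA => v /=.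
by rewrite !eval_subst; apply: (e12 (fun a => v (r a))).
Qed.

(** Merges two valuations on disjoint variables, so that two words can be multiplied or compared
    under one valuation. *)
Definition interleave T (e1 e2 : nat -> T) i :=
  if odd i then e2 i./2 else e1 i./2.

Definition subst_even := subst (fun i => Var i.*2).
Definition subst_odd := subst (fun i => Var i.*2.+1).

Lemma eval_subst_even (B : baseGroupType) (e1 e2 : nat -> B) t :
  term_eval (interleave e1 e2) (subst_even t) = term_eval e1 t.
Proof.
rewrite eval_subst; apply: eq_term_eval => i _ /=.
by rewrite /interleave odd_double doubleK.
Qed.

Lemma eval_subst_odd (B : baseGroupType) (e1 e2 : nat -> B) t :
  term_eval (interleave e1 e2) (subst_odd t) = term_eval e2 t.
Proof.
rewrite eval_subst; apply: eq_term_eval => i _ /=.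
by rewrite /interleave /= odd_double /= uphalf_double.
Qed.

Lemma interleave_comp T U (v : T -> U) (e1 e2 : nat -> T) :
  (fun i => v (interleave e1 e2 i))
  = interleave (fun i => v (e1 i)) (fun i => v (e2 i)).
Proof. by apply: funext => i; rewrite /interleave; case: odd. Qed.

(* [f] is the element of the relatively free group on [A], realised inside
   the power of [G] indexed by all maps [A -> G], given by the word [t] in
   the generators [e 0, e 1, ...]. *)
Definition represents (f : product_structure (fun _ : A -> G => G)) t e :=
  forall v : A -> G, f v = term_eval (fun i => v (e i)) t.

(** Makes evaluation in [A] well defined on the relatively free group. *)
Lemma represents_uniq f t1 e1 t2 e2 :
  represents f t1 e1 -> represents f t2 e2 -> term_eval e1 t1 = term_eval e2 t2.
Proof.
move=> f1 f2; rewrite -(eval_subst_even e1 e2) -[RHS](eval_subst_odd e1 e2).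
apply: eval_eq_of_free => v.
by rewrite interleave_comp eval_subst_even eval_subst_odd -f1 -f2.
Qed.

Lemma representsM f1 f2 t1 e1 t2 e2 :
    represents f1 t1 e1 -> represents f2 t2 e2 ->
  represents (f1 * f2) (Mul (subst_even t1) (subst_odd t2)) (interleave e1 e2).
Proof.
move=> r1 r2 v.
by rewrite interleave_comp /= eval_subst_even eval_subst_odd -r1 -r2.
Qed.

Lemma representsV f t e : represents f t e -> represents f^-1 (Inv t) e.
Proof. by move=> r v; rewrite /= -r. Qed.

Definition relatively_free : subgroup (product_structure (fun _ : A -> G => G)).
Proof.
exists (fun f => exists t e, represents f t e).
- by exists One, (fun=> 1).
- move=> f1 f2 [t1 [e1 r1]] [t2 [e2 r2]].
  by do 2 eexists; apply: representsM r1 r2.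
- by move=> f [t [e r]]; do 2 eexists; apply: representsV r.
Defined.

(** [A] is the image, under evaluation of representing words, of a subgroup of a power of [G]; the
    coordinate function at [a] is sent to [a]. *)
Lemma birkhoff : variety_generated_by G A.
Proof.
move=> V [_ Vhom Vsub Vprod] VG.
have VF : V (subgroup_sort relatively_free) by apply/Vsub/Vprod.
have /choice[phi phiP] (h : subgroup_sort relatively_free) :
    exists a, exists t e, represents (sval h) t e /\ term_eval e t = a.
  by case: h => f [t [e r]] /=; exists (term_eval e t), t, e.
have phiE (h : subgroup_sort relatively_free) t e :
    represents (sval h) t e -> phi h = term_eval e t.
  by move=> r; case: (phiP h) => t' [e' [r' <-]]; apply: represents_uniq r' r.
apply: (Vhom _ A phi) VF => [|a].
  split=> [|x y|x].
  - by rewrite (@phiE _ One (fun=> 1)).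
  - have [[t1 [e1 [r1 <-]]] [t2 [e2 [r2 <-]]]] := (phiP x, phiP y).
    rewrite (phiE (x * y) _ _ (representsM r1 r2)) /=.
    by rewrite eval_subst_even eval_subst_odd.
  - have [t [e [r <-]]] := phiP x.
    exact: (phiE x^-1 _ _ (representsV r)).
have Fa : relatively_free (fun v => v a) by exists (Var 0), (fun=> a).
by exists (exist _ _ Fa); rewrite (@phiE _ (Var 0) (fun=> a)).
Qed.

End Birkhoff.

Lemma variety_generated_byP (G A : baseGroupType) :
  is_group G -> variety_generated_by G A <-> models_laws G A.
Proof.
move=> gG; split=> [GA|]; last exact: birkhoff.
exact: (GA (models_laws G) (models_laws_variety gG)).
Qed.

(** * Finite bases for laws in boundedly many variables *)

Definition universal_closure (f : formula) := foldr All f (free_vars f).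

Lemma free_vars_foldr_All s f :
  free_vars (foldr All f s) = [seq i <- free_vars f | i \notin s].
Proof.
elim: s => [|n s IHs] /=; first by rewrite filter_predT.
by rewrite IHs -filter_predI; apply: eq_filter => i; rewrite inE negb_or.
Qed.

Lemma sentence_universal_closure f : sentence (universal_closure f).
Proof.
rewrite /sentence free_vars_foldr_All -(filter_pred0 (free_vars f)).
by apply: eq_in_filter => i /= ->.
Qed.

Lemma satisfies_universal_closure A f :
  satisfies A (universal_closure f) <-> satisfies A f.
Proof.
rewrite /universal_closure; elim: (free_vars f) => [|n s [IH1 IH2]] //=.
split=> [Af|/IH2 Af e a]; last exact: Af.
apply: IH1 => e; have := Af e (e n); congr (holds _ _).
by apply: funext => i; rewrite /update; case: eqP => // ->.
Qed.

Lemma Forall_mapP (T : eqType) (U : Type) (P : U -> Prop) (f : T -> U) s :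
  List.Forall P [seq f x | x <- s] <-> {in s, forall x, P (f x)}.
Proof.
elim: s => [|x s [IH1 IH2]] /=; first by split.
split=> [/List.Forall_cons_iff[Px /IH1 Ps] y|Ps].
  by rewrite inE => /predU1P[-> //|]; apply: Ps.
constructor; first by apply: Ps; rewrite mem_head.
by apply: IH2 => y sy; apply: Ps; rewrite inE sy orbT.
Qed.

(* There are finitely many [n]-variable words up to equality in [G]; once a
   representative of each is chosen, the multiplication table of the
   representatives implies all laws. *)
Lemma finite_basis (G : finGroupType) n : exists L : seq formula,
  (forall A, models_laws G A -> List.Forall (satisfies A) L) /\
  (forall A, List.Forall (satisfies A) L ->
     forall t1 t2, satisfies G (Eq t1 t2) ->
     forall e : nat -> A, (forall i, n <= i -> e i = 1) ->
       term_eval e t1 = term_eval e t2).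
Proof.
(* Words in $n$ variables are compared through the functions $G^n \to G$ they induce, of which there
   are finitely many. *)
pose K := {ffun {ffun 'I_n -> G} -> G}.
pose ext (v : {ffun 'I_n -> G}) i := oapp v 1 (insub i).
pose val t : K := [ffun v => term_eval (ext v) t].
have /choice[r rP] (q : K) : exists t, (exists t', val t' = q) -> val t = q.
  by case: (EM (exists t', val t' = q)) => [[t vt]|nq]; [exists t | exists One].
have valr t : val (r (val t)) = val t by apply: rP; exists t.
pose trunc := subst (fun i => if i < n then Var i else One).
have eval_trunc (A : baseGroupType) (e : nat -> A) t :
    term_eval e (trunc t) = term_eval (fun i => if i < n then e i else 1) t.
  by rewrite eval_subst; apply: eq_term_eval => i _; case: ifP.
pose law t := Eq (trunc t) (trunc (r (val t))).
have Glaw t : satisfies G (law t).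
  move=> e /=; rewrite !eval_trunc.
  have -> : (fun i => if i < n then e i else 1) = ext [ffun j : 'I_n => e j].
    apply: funext => i; rewrite /ext.
    by case: insubP => [j -> <-|/negPf->] //=; rewrite ffunE.
  by have /ffunP/(_ [ffun j : 'I_n => e j]) := valr t; rewrite !ffunE.
(* One entry of the multiplication table per term constructor applied to representatives. *)
pose node (x : option ('I_n + K + K * K)) := match x with
  | None => One
  | Some (inl (inl i)) => Var i
  | Some (inl (inr q)) => Inv (r q)
  | Some (inr (p, q)) => Mul (r p) (r q)
  end.
exists [seq law (node x) | x <- enum {: option ('I_n + K + K * K)}]; split=> A.
  by move=> GA; apply/Forall_mapP => x _; apply/GA/Glaw.
move/Forall_mapP => AL t1 t2 G12 e e1.
have Anode x : term_eval e (node x) = term_eval e (r (val (node x))).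
  have := AL x (mem_enum _ x) e; rewrite /= !eval_trunc.
  suff -> : (fun i => if i < n then e i else 1) = e by [].
  by apply: funext => i; case: ltnP => // /e1.
have valV t : val (Inv (r (val t))) = val (Inv t).
  by apply/ffunP=> v; have /ffunP/(_ v) := valr t; rewrite !ffunE /= => ->.
have valM s t : val (Mul (r (val s)) (r (val t))) = val (Mul s t).
  apply/ffunP=> v; have /ffunP/(_ v) := valr s; have /ffunP/(_ v) := valr t.
  by rewrite !ffunE /= => -> ->.
(* Induction on the word: the laws at the nodes reduce it to its representative in [A]. Variables of
   index at least $n$ are treated as [One], which agrees with [e]. *)
have evalr t : term_eval e t = term_eval e (r (val t)).
  elim: t => [i||t IHt|s IHs t IHt] /=.
  - have [lt_in|le_ni] := ltnP i n.
      exact: (Anode (Some (inl (inl (Ordinal lt_in))))).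
    have -> : val (Var i) = val One.
      by apply/ffunP=> v; rewrite !ffunE /= /ext insubF // ltnNge le_ni.
    by rewrite e1 //; apply: (Anode None).
  - exact: (Anode None).
  - by rewrite IHt -valV; apply: (Anode (Some (inl (inr (val t))))).
  - by rewrite IHs IHt -valM; apply: (Anode (Some (inr (val s, val t)))).
rewrite evalr [RHS]evalr; congr (term_eval e (r _)).
by apply/ffunP=> v; rewrite !ffunE; apply: G12.
Qed.

(** * Nilpotency through commutator words *)

(** The left-normed commutator of the $n+1$ variables [Var 0], ..., [Var n], spelled out as
    [[~ x, y]] unfolds. *)
Fixpoint bracket (n : nat) : term :=
  if n is n'.+1 then
    let s := bracket n' in let t := Var n'.+1 in
    Mul (Inv s) (Mul (Inv t) (Mul s t))
  else Var 0.

Lemma term_vars_bracket n i : i \in term_vars (bracket n) -> i <= n.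
Proof.
elim: n => [|n IHn] /=; first by rewrite inE => /eqP->.
by rewrite !(mem_cat, inE) => /or4P[/IHn/leqW|/eqP->|/IHn/leqW|/eqP->].
Qed.

Section Bracket.

Variable H : groupType.

Lemma eval_bracket_ucs c n (e : nat -> H) :
  ucs c (e 0) -> ucs (c - n) (term_eval e (bracket n)).
Proof.
elim: n => [|n IHn] Ze /=; first by rewrite subn0.
by rewrite subnS; apply: (ucsP (e n.+1)); apply: IHn.
Qed.

(** Each step trades the last variable for one term of the upper central series; at $n = 0$ every
    element lies in $Z_m$. *)
Lemma ucs_eval_bracket m n :
    (forall e : nat -> H, term_eval e (bracket (m + n)) = 1) ->
  forall e : nat -> H, ucs m (term_eval e (bracket n)).
Proof.
elim: m n => [|m IHm] n // law1 e y.
have -> : [~ term_eval e (bracket n), y]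
    = term_eval (update e n.+1 y) (bracket n.+1).
  have -> : term_eval e (bracket n) = term_eval (update e n.+1 y) (bracket n).
    apply: eq_term_eval => i /term_vars_bracket le_in.
    by rewrite /update ltn_eqF.
  by rewrite /= /update eqxx.
by apply: IHm => e'; rewrite addnS -addSn.
Qed.

End Bracket.

(** Induction on $i$ gives $L_{c+1-i} \le Z_i$; the lower series starts at $L_1 = G$, so $i = c$
    covers the group. *)
Lemma nilpotent_ucs (G : finGroupType) :
  nilpotent [set: G] -> exists c, forall x : G, ucs c x.
Proof.
case/lcnP=> c Lc1; exists c.
suff lcn_ucs i (x : G) : i <= c -> x \in 'L_(c.+1 - i)([set: G]) -> ucs i x.
  by move=> x; apply: lcn_ucs => //; rewrite subSnn lcn1 inE.
elim: i x => [|i IHi] x le_ic; first by rewrite subn0 Lc1 => /set1P.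
rewrite subSS => Lx y; apply: IHi; first exact: ltnW.
rewrite subSn 1?ltnW //; rewrite -subn_gt0 in le_ic.
by case: (c - i) le_ic Lx => // k _ Lx; rewrite lcnSn mem_commg ?inE.
Qed.

(** A non-central element of $N$ has a nontrivial commutator, again in $N$ and one step lower in the
    upper central series. *)
Lemma nontrivial_normal_center (H : groupType) (N : subgroup H) c :
    (forall x : H, ucs c x) -> is_normal N -> is_nontrivial N ->
  exists z, [/\ N z, z <> 1 & forall y, commute z y].
Proof.
move=> nilH nN [x Nx x1]; have := nilH x.
elim: c {nilH} x Nx x1 => [|c IHc] x Nx x1 //= Zx.
case: (EM (forall y, [~ x, y] = 1)) => [cx|/existsNP[y xy1]].
  by exists x; split=> // y; apply/commgP; rewrite cx.
apply: (IHc [~ x, y]) => //.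
by rewrite commgEl; apply: sg_M; [apply: sg_V | apply: nN].
Qed.

(** * A first-order sentence for subdirect irreducibility *)

Fixpoint term_pow (k : nat) (t : term) : term :=
  if k is k'.+1 then Mul t (term_pow k' t) else One.

Lemma eval_term_pow (H : groupType) (e : nat -> H) k t :
  term_eval e (term_pow k t) = term_eval e t ^+ k.
Proof. by elim: k => //= k ->; rewrite expgS. Qed.

Lemma holds_disjunction (A : baseGroupType) (e : nat -> A)
    (f : nat -> formula) s :
  holds e (foldr Or Bot [seq f k | k <- s]) <->
  exists2 k, k \in s & holds e (f k).
Proof.
elim: s => [|k s [IH1 IH2]] /=; first by split=> [|[]].
split=> [[fk|/IH1[j sj fj]]|[j]].
- by exists k; rewrite ?mem_head.
- by exists j; rewrite ?inE ?sj ?orbT.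
- by rewrite inE => /predU1P[->|sj fj]; [left | right; apply: IH2; exists j].
Qed.

Definition is_central (A : baseGroupType) (x : A) : Prop :=
  forall y, x * y = y * x.

Definition si_formula (m : nat) : formula :=
  Ex 0 (And (Not (Eq (Var 0) One))
    (All 1 (Imp
      (And (Not (Eq (Var 1) One))
           (All 2 (Eq (Mul (Var 1) (Var 2)) (Mul (Var 2) (Var 1)))))
      (foldr Or Bot [seq Eq (Var 0) (term_pow k (Var 1)) | k <- iota 0 m])))).

Lemma satisfies_si_formula (H : groupType) m :
  satisfies H (si_formula m) <->
  exists2 x : H, x <> 1 & forall y : H, y <> 1 -> is_central y ->
    exists2 k, k < m & x = y ^+ k.
Proof.
split=> [/(_ (fun=> 1)) [x [x1 xP]]|[x x1 xP] e].
  exists x => // y y1 cy.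
  have /holds_disjunction[k] := xP y (conj y1 cy).
  rewrite mem_iota /= eval_term_pow /= => lt_km xE.
  by exists k.
exists x; split=> // y [y1 cy]; have [k lt_km xE] := xP y y1 cy.
apply/holds_disjunction; exists k; first by rewrite mem_iota.
by rewrite /= eval_term_pow.
Qed.

Definition cyclic_subgroup (H : groupType) m (m_gt0 : 0 < m)
  (xm : forall x : H, x ^+ m = 1) (y : H) : subgroup H.
Proof.
exists (fun x => exists k, x = y ^+ k).
- by exists 0%N.
- by move=> _ _ [i ->] [j ->]; exists (i + j); rewrite expgnDr.
(* Natural exponents suffice: $y^m = 1$ makes $y^{i(m-1)}$ the inverse of $y^i$. *)
- move=> _ [i ->]; exists (i * m.-1)%N.
  apply/(mulgI (y ^+ i)); rewrite mulgV -expgnDr -mulnS prednK //.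
  by rewrite mulnC expgnA xm expg1n.
Defined.

Definition normal_intersection (H : groupType) : subgroup H.
Proof.
exists (fun x => forall N : subgroup H, is_normal N -> is_nontrivial N -> N x).
- by move=> N _ _; apply: sg_1.
- by move=> x y Mx My N nN ntN; apply: sg_M; [apply: Mx | apply: My].
- by move=> x Mx N nN ntN; apply/sg_V/Mx.
Defined.

Section Monolith.

Variables (H : groupType) (c : nat).
Hypothesis nilH : forall x : H, ucs c x.

(** Powers of a central $y \ne 1$ form a nontrivial normal subgroup, which contains the monolith and
    so its element $z$; exponents reduce modulo [m]. *)
Lemma si_formula_of_si m : 0 < m -> (forall x : H, x ^+ m = 1) ->
  subdirectly_irreducible H -> satisfies H (si_formula m).
Proof.
move=> m_gt0 xm [_ [M [nM ntM minM]]].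
have [z [Mz z1 _]] := nontrivial_normal_center nilH nM ntM.
apply/satisfies_si_formula; exists z => // y y1 cy.
pose N := cyclic_subgroup m_gt0 xm y.
have nN : is_normal N.
  move=> _ g [k ->]; exists k; apply: conjg_fixP.
  by apply/commgP/commute_sym/commuteX/commute_sym/cy.
have [k zE] : N z.
  by apply: minM Mz => //; exists y => //; exists 1%N; rewrite expg1.
exists (k %% m); rewrite ?ltn_pmod // zE {1}(divn_eq k m).
by rewrite expgnDr mulnC expgnA xm expg1n mul1g.
Qed.

(** Every nontrivial normal subgroup contains a central $y \ne 1$, hence its power $z$; so the
    intersection of them all is nontrivial. *)
Lemma si_of_si_formula m :
  satisfies H (si_formula m) -> subdirectly_irreducible H.
Proof.
case/satisfies_si_formula=> z z1 zP; split; first exact: groupType_is_group.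
exists (normal_intersection H); split.
- by move=> x g Mx N nN ntN; apply/nN/Mx.
- exists z => // N nN ntN.
  have [y [Ny y1 cy]] := nontrivial_normal_center nilH nN ntN.
  have [k _ ->] := zP y y1 cy.
  by elim: k => [|k IHk]; rewrite ?expg0 ?expgS; [apply: sg_1 | apply: sg_M].
- by move=> N nN ntN x; apply.
Qed.

End Monolith.

(** * Assembling the finite axiom system *)

Theorem theorem1p1 (G : finGroupType) (nilG : nilpotent [set: G]) :
  exists Sigma : seq formula,
    List.Forall sentence Sigma /\
    forall A : baseGroupType,
      (variety_generated_by G A /\ subdirectly_irreducible A) <->
      List.Forall (satisfies A) Sigma.
Proof.
have gG : is_group G by apply: groupType_is_group.
have [c nilGc] := nilpotent_ucs nilG.
pose m := #|[set: G]|; have m_gt0 : 0 < m by apply: cardG_gt0.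
have G_pow : satisfies G (Eq (term_pow m (Var 0)) One).
  by move=> e; rewrite /= eval_term_pow expg_cardG ?inE.
have G_bracket : satisfies G (Eq (bracket c) One).
  move=> e; have := eval_bracket_ucs c (nilGc (e 0)).
  by rewrite subnn.
(* $c+3$ variables cover the 3 of the group axioms, the $c+1$ of [bracket c] and the $c$ of
   small-support tuples. *)
have [L [GL LG]] := finite_basis G c.+3.
exists [seq universal_closure f | f <- si_formula m :: L]; split.
  elim: (_ :: L) => //= f s IHs; constructor=> //.
  exact: sentence_universal_closure.
have closureP A s : List.Forall (satisfies A) [seq universal_closure f | f <- s]
    <-> List.Forall (satisfies A) s.
  elim: s => //= f s IHs.
  by rewrite !List.Forall_cons_iff satisfies_universal_closure IHs.
move=> A; rewrite closureP List.Forall_cons_iff variety_generated_byP //.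
have nilA (H : groupType) :
    (forall e : nat -> H, (forall i, c.+3 <= i -> e i = 1) ->
       term_eval e (bracket c) = 1) -> forall x : H, ucs c x.
  move=> law1 x; apply: (@ucs_eval_bracket H c 0 _ (fun=> x)) => e.
  rewrite addn0 -(law1 (fun i => if i < c.+3 then e i else 1)); last first.
    by move=> i; rewrite leqNgt => /negPf->.
  by apply: eq_term_eval => i /term_vars_bracket le_ic; rewrite ltnS !leqW.
split=> [[GA siA]|[siA AL]].
  have [H HA] := is_group_groupType (models_laws_group gG GA).
  case: A / HA GA siA => GH siH.
  split; last exact: GL.
  apply: (si_formula_of_si (c := c)) siH => // [|x].
    by apply: nilA => e _; apply: (GH _ _ G_bracket).
  by have := GH _ _ G_pow (fun=> x); rewrite /= eval_term_pow.
(* The axioms yield first a group, then class at most [c], and only then all laws of [G]. *)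
have {GL}LA := LG A AL.
have gA : is_group A.
  apply: is_group_of_laws gG _ => t1 t2 G12 e e1.
  by apply: LA => // i le_i; apply: e1; apply: leq_trans le_i.
have [H HA] := is_group_groupType gA; case: A / HA siA LA {AL gA} => siH LH.
have nilH (x : H) : ucs c x by apply: nilA => e; apply: (LH _ _ G_bracket).
split; last exact: (si_of_si_formula nilH siH).
move=> t1 t2 G12; apply: (small_support_law nilH) => S a leSc aS.
(* Renaming the support [S] to its positions, all below [c], turns the instance into one covered by
   the finite basis. *)
pose u i := if i \in S then Var (index i S) else One.
pose e j := if j < size S then a (nth 0 S j) else 1.
have eval_u t : term_eval e (subst u t) = term_eval a t.
  rewrite eval_subst; apply: eq_term_eval => i _; rewrite /u.
  case: ifPn => [Si|/aS-> //] /=.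
  by rewrite /e index_mem Si nth_index.
rewrite -!eval_u; apply: LH => [v /=|i le_i].
  by rewrite !eval_subst; apply: G12.
by rewrite /e ltnNge (leq_trans leSc) // (leq_trans _ le_i) // !leqW.
Qed.
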